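(* Let $\phi:\mathbb{R}\to\mathbb{R}_+$ be a non-negative convex function. Assume that for all $l\in\{1,\dots,L\}$ the function $\phi$ is classification-calibrated, i.e. $(f_\phi^* )^l(\eta^l)>0$ when $\eta^l>p_0$ and $(f_\phi^* )^l(\eta^l)<0$ when $\eta^l<p_0$. Assume that there exist $c>0$ and $s\ge1$ such that for all $l\in\{1,\dots,L\}$ and all $\eta^l\in[0,1]$, $$|p_0-\eta^l|^s\le c^s\,\Delta\mathcal{R}_\phi^w(\eta^l,0).$$ Then for any measurable vector function $f:\mathcal{X}\to\mathbb{R}^L$, $$\mathcal{R}^w_{0/1}(f)-\mathcal{R}^{w*}_{0/1}\le c\,L^{\frac{s-1}{s}}\left(\mathcal{R}_\phi^w(f)-\mathcal{R}_\phi^w(f_\phi^* )\right)^{\frac1s}.$$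
   Context: Let $\mathcal{X}=\mathbb{R}^D$ and let $(X,Y)$ be a random pair with values in $\mathcal{X}\times\{0,1\}^L$. Let $\eta(X)=(\eta^1(X),\dots,\eta^L(X))^\top$ with $\eta^l(X)=\mathbb{P}\{Y^l=1\mid X\}$. The weights are $p_0=\frac{2K}{L}$, $p_1=1-\frac{2K}{L}$, both nonnegative, where $K<L$ is the positive integer sparsity level for which $\mathbb{P}\{\sum_{l=1}^L\mathbb{1}_{\{Y^l=1\}}>K\mid X\}=0$ almost surely. The weighted Hamming risk of a measurable $f=(f^1,\dots,f^L):\mathcal{X}\to\mathbb{R}^L$ (through the classifier predicting $1$ for label $l$ iff $f^l(x)\ge0$) is $$\mathcal{R}^w_{0/1}(f)=\sum_{l=1}^L\Big\{p_0\mathbb{E}[\mathbb{1}_{\{f^l(X)\ge0\}}\mathbb{1}_{\{Y^l=0\}}]+p_1\mathbb{E}[\mathbb{1}_{\{f^l(X)<0\}}\mathbb{1}_{\{Y^l=1\}}]\Big\},$$ and $\mathcal{R}^{w*}_{0/1}$ is its minimum over measurable $f$, equal to its value at $f^l(x)=\eta^l(x)-p_0$. The convexified risk is $$\mathcal{R}_\phi^w(f)=\sum_{l=1}^L\Big\{p_0\mathbb{E}[\phi(-f^l(X))\mathbb{1}_{\{Y^l=0\}}]+p_1\mathbb{E}[\phi(f^l(X))\mathbb{1}_{\{Y^l=1\}}]\Big\}.$$ For $\eta^l\in[0,1]$ and $v\in\mathbb{R}$ write $\mathcal{R}_\phi^w(\eta^l,v)=p_1\eta^l\phi(v)+p_0(1-\eta^l)\phi(-v)$,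 so that $\mathcal{R}_\phi^w(f)=\sum_{l=1}^L\mathbb{E}_X[\mathcal{R}_\phi^w(\eta^l(X),f^l(X))]$. Let $(f_\phi^* )^l(\eta^l)$ denote a minimizer of $v\mapsto\mathcal{R}_\phi^w(\eta^l,v)$ (assumed to exist), let $f_\phi^*$ also denote the function $x\mapsto((f_\phi^* )^1(\eta^1(x)),\dots,(f_\phi^* )^L(\eta^L(x)))$ when it appears as an argument of $\mathcal{R}_\phi^w$, and define $$\Delta\mathcal{R}_\phi^w(\eta^l,v)=\mathcal{R}_\phi^w(\eta^l,v)-\mathcal{R}_\phi^w(\eta^l,(f_\phi^* )^l(\eta^l)).$$ *)

(* Defs.v *)
From mathcomp Require Import all_boot all_order all_algebra.
From mathcomp Require Import all_classical all_reals all_analysis.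

Set Implicit Arguments.
Unset Strict Implicit.
Unset Printing Implicit Defensive.

Import Order.TTheory GRing.Theory Num.Theory.
Import numFieldNormedType.Exports.

Local Open Scope classical_set_scope.
Local Open Scope ring_scope.

(* R^n is [n.-tuple R] and {0,1}^L is [L.-tuple bool] ([true] is 1), both with
   the product sigma-algebra; the former is the Borel sigma-algebra of R^n. *)

Definition p0 (R : realType) (L K : nat) : R := (2 * K)%:R / L%:R.

Definition p1 (R : realType) (L K : nat) : R := 1 - p0 R L K.

(* [q \o X] is a version of P(A | X).  It determines q only up to a null set of
   the law of X; the version is taken with values in [0, 1], so that a function
   defined on [0, 1] can be composed with it. *)
Definition is_cond_prob (R : realType) (d d' : measure_display)
    (Omega : measurableType d) (T : measurableType d')
    (P : probability Omega R) (X : {RV P >-> T}) (A : set Omega) (q : T -> R) :=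
  [/\ measurable_fun [set: T] q,
      forall x, 0 <= q x <= 1 &
      forall B : set T, measurable B ->
        (P (X @^-1` B `&` A) = \int[P]_(w in X @^-1` B) (q (X w))%:E)%E].

Section risks.
Context (R : realType) (d : measure_display) (Omega : measurableType d).
Context (P : probability Omega R) (D L K : nat).
Context (X : {RV P >-> D.-tuple R}) (Y : {RV P >-> L.-tuple bool}).

Definition risk01 (f : D.-tuple R -> L.-tuple R) : \bar R :=
  (\sum_(l < L)
     ((p0 R L K)%:E *
        'E_P[fun w => ((0 <= tnth (f (X w)) l)%R%:R
                       * (tnth (Y w) l == false)%:R)%R]
      + (p1 R L K)%:E *
        'E_P[fun w => ((tnth (f (X w)) l < 0)%R%:R
                       * (tnth (Y w) l == true)%:R)%R]))%E.

Definition risk01_opt : \bar R :=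
  ereal_inf [set risk01 g | g in
    [set g : D.-tuple R -> L.-tuple R | measurable_fun [set: D.-tuple R] g]].

(* The two expectations are of nonnegative functions; the value may be +oo,
   and 0 * +oo = 0. *)
Definition risk_phi (phi : R -> R) (f : D.-tuple R -> L.-tuple R) : \bar R :=
  (\sum_(l < L)
     ((p0 R L K)%:E *
        'E_P[fun w => (phi (- tnth (f (X w)) l)
                       * (tnth (Y w) l == false)%:R)%R]
      + (p1 R L K)%:E *
        'E_P[fun w => (phi (tnth (f (X w)) l)
                       * (tnth (Y w) l == true)%:R)%R]))%E.

End risks.

Definition risk_pt (R : realType) (L K : nat) (phi : R -> R) (e v : R) : R :=
  p1 R L K * e * phi v + p0 R L K * (1 - e) * phi (- v).

(* [fstar l e] minimizes v |-> risk_pt e v for each e in [0, 1]; its values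
   outside [0, 1] play no role. *)
Definition is_minimizer (R : realType) (L K : nat) (phi : R -> R)
    (fstar : 'I_L -> R -> R) :=
  forall (l : 'I_L) (e : R), 0 <= e <= 1 ->
    forall v, risk_pt L K phi e (fstar l e) <= risk_pt L K phi e v.

Definition classification_calibrated (R : realType) (L K : nat)
    (fstar : 'I_L -> R -> R) :=
  forall (l : 'I_L) (e : R), 0 <= e <= 1 ->
    (p0 R L K < e -> 0 < fstar l e) /\ (e < p0 R L K -> fstar l e < 0).

Definition excess_pt (R : realType) (L K : nat) (phi : R -> R)
    (fstar : 'I_L -> R -> R) (l : 'I_L) (e v : R) : R :=
  risk_pt L K phi e v - risk_pt L K phi e (fstar l e).

Definition compose_fstar (R : realType) (D L : nat) (fstar : 'I_L -> R -> R)
    (eta : D.-tuple R -> L.-tuple R) (x : D.-tuple R) : L.-tuple R :=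
  [tuple fstar l (tnth (eta x) l) | l < L].

(* Main.v *)
(* If f^l(x) has the wrong sign for e = eta^l(x), then 0 lies between f^l(x) and
   the minimizer fstar^l(e), so by convexity the excess phi-risk at f^l(x) is at
   least the excess at 0, which controls |p0 - e|^s by hypothesis.  By Young's
   inequality |p0 - e| <= |p0 - e|^s t^(1-s) / s + (1 - 1/s) t, this gives, with
   k = c^s t^(1-s) / s and for every t > 0 and measurable g,
     R01(f) + k Rphi(fstar) <= R01(g) + k Rphi(f) + (1 - 1/s) t L,
   first pointwise, then after integration against the law of X; all the terms
   are nonnegative, so infinite values are harmless.  Optimizing in t yields the
   bound. *)

Require Import Defs.
From mathcomp Require Import all_boot all_order all_algebra.
From mathcomp Require Import all_classical all_reals all_analysis.
From mathcomp Require Import measurable_realfun ring lra.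

Set Implicit Arguments.
Unset Strict Implicit.
Unset Printing Implicit Defensive.

Import Order.TTheory GRing.Theory Num.Theory.
Import numFieldNormedType.Exports.

Local Open Scope classical_set_scope.
Local Open Scope ring_scope.

(** * Young's inequality and the optimization of its parameter *)

Section real_inequalities.
Context {R : realType}.
Implicit Types (A E c n s t u : R).

(** Young's inequality for the product of [u / t] and 1, with exponent [s] and its conjugate,
    multiplied through by [t]. The quotient of [t] by its [s]-th power is t^(1-s). *)
Lemma powR_young s t u : 1 <= s -> 0 < t -> 0 <= u ->
  u <= u `^ s * (t / t `^ s) / s + (1 - s^-1) * t.
Proof.
move=> s1 t0 u0; have s0 : 0 < s by apply: lt_le_trans s1.
(* For [s = 1] the conjugate exponent is infinite, but both sides equal [u]. *)
have [->|sn1] := eqVneq s 1.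
  by rewrite !powRr1 ?(ltW t0)// divff ?gt_eqF// invr1; lra.
have {sn1}s1 : 1 < s by rewrite lt_neqAle eq_sym sn1.
have ut0 : 0 <= u / t by rewrite divr_ge0// ltW.
have := @conjugate_powR R (u / t) 1 s (1 - s^-1)^-1 ut0 ler01 s0.
rewrite invr_gt0 subr_gt0 invf_lt1// invrK => /(_ s1).
rewrite addrCA subrr addr0 => /(_ erefl); rewrite mulr1 powR1 mul1r.
have -> : u `^ s = (u / t) `^ s * t `^ s.
  by rewrite -powRM// ?(ltW t0)// divfK ?gt_eqF.
rewrite -(ler_pM2r t0) divfK ?gt_eqF// => /le_trans; apply.
have ts : t `^ s != 0 by rewrite gt_eqF// powR_gt0.
by rewrite le_eqVlt; apply/orP; left; apply/eqP; field; rewrite ts gt_eqF.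
Qed.

(* The bound is minimized over [t] at [t = c * (E / n) `^ s^-1]. *)
Lemma young_optimum A c E n s : 0 < c -> 0 <= E -> 0 < n -> 1 <= s ->
  (forall t, 0 < t ->
     A <= (c `^ s * (t / t `^ s) / s) * E + (1 - s^-1) * t * n) ->
  A <= c * n `^ ((s - 1) / s) * E `^ s^-1.
Proof.
move=> c0 E0 n0 s1 H; have s0 : 0 < s by apply: lt_le_trans s1.
have si0 : 0 < s^-1 by rewrite invr_gt0.
move: E0; rewrite le_eqVlt => /orP[/eqP E0|E0].
  rewrite -E0 powR0 ?gt_eqF// mulr0 leNgt; apply/negP => A0.
  (* For [E = 0] the minimizing [t] would be 0, which is excluded. This small [t] turns the
     hypothesis into A <= (1 - 1/s) A / 2, absurd for positive [A]. *)
  have tn0 : 0 < A / (2 * n) by rewrite divr_gt0// mulr_gt0.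
  have := H _ tn0; rewrite -E0 mulr0 add0r.
  have -> : (1 - s^-1) * (A / (2 * n)) * n = (1 - s^-1) * (A / 2).
    by field; rewrite !gt_eqF.
  nra.
pose r := (E / n) `^ s^-1.
have r0 : 0 < r by rewrite powR_gt0// divr_gt0.
have rs : r `^ s = E / n.
  by rewrite -powRrM mulVf ?gt_eqF// powRr1// divr_ge0// ltW.
have cr0 : 0 < c * r by rewrite mulr_gt0.
apply: le_trans (H _ cr0) _.
rewrite powRM ?(ltW c0) ?(ltW r0)// rs.
have cs : c `^ s != 0 by rewrite gt_eqF// powR_gt0.
(* The two terms are c r n / s and (1 - 1/s) c r n. *)
rewrite (_ : _ + _ = c * r * n); last first.
  by field; rewrite cs !gt_eqF.
rewrite /r powRM ?invr_ge0 ?(ltW E0) ?(ltW n0)// -[n^-1]powR_inv1 ?(ltW n0)//.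
rewrite -powRrM mulN1r powRN mulrBl divff ?gt_eqF// mul1r.
rewrite powRB ?(gt_eqF n0) ?implybT// powRr1 ?(ltW n0)//.
by rewrite le_eqVlt; apply/orP; left; apply/eqP; ring.
Qed.

End real_inequalities.

(** * Measurability from convexity and from monotonicity *)

Section convex.
Context {R : realType}.
Implicit Types phi q : R -> R.

(** Sublevel sets of a convex function are intervals. *)
Lemma convex_le_between phi (a b x r : R) :
  convex_function [set: R^o] phi -> a <= x <= b ->
  phi a <= r -> phi b <= r -> phi x <= r.
Proof.
move=> cphi /andP[ax xb] ar br.
have [t t01 xE] : exists2 t : R, 0 <= t <= 1 & x = t * a + (1 - t) * b.
  have [ab|ab] := eqVneq a b.
    by exists 1; rewrite ?ler01 ?lexx//; move: ax xb; rewrite -ab; lra.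
  have ab0 : 0 < b - a by rewrite subr_gt0 lt_neqAle ab (le_trans ax).
  exists ((b - x) / (b - a)); last by field; rewrite gt_eqF.
  rewrite ler_pdivrMr// mul1r lerD2l lerN2 ax andbT.
  by rewrite divr_ge0 ?(ltW ab0)// subr_ge0.
have /andP[t0 t1] := t01.
have /le_trans : phi x <= t * phi a + (1 - t) * phi b.
  by rewrite xE; apply: (cphi (Itv01 t0 t1)); rewrite inE.
apply; rewrite (_ : r = t * r + (1 - t) * r); last by ring.
by rewrite lerD// ler_wpM2l// subr_ge0.
Qed.

(** The preimage of an open upper ray is the complement of a sublevel set, which is an interval. *)
Lemma convex_measurable phi :
  convex_function [set: R^o] phi -> measurable_fun [set: R] phi.
Proof.
move=> cphi; apply: (measurability (@RGenOInfty.G R)).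
  exact: RGenOInfty.measurableE.
move=> /= _ [_ [r ->] <-]; rewrite setTI -(setCK (_ @^-1` _)).
apply: measurableC; apply: is_interval_measurable => a b /= ra rb x axb.
move: ra rb; rewrite !in_itv/= !andbT => /negP; rewrite -leNgt => ra.
move=> /negP; rewrite -leNgt => rb; apply/negP; rewrite -leNgt.
exact: convex_le_between axb ra rb.
Qed.

(** Precomposing [phi] with the projection onto [0, 1] makes it monotone on the whole line, and the
    projection fixes the values of [q]. *)
Lemma measurable_nondecreasing01 d (T : measurableType d) phi (q : T -> R) :
  {in `[0, 1]%R &, {homo phi : x y / x <= y}} ->
  measurable_fun [set: T] q -> (forall x, 0 <= q x <= 1) ->
  measurable_fun [set: T] (fun x => phi (q x)).
Proof.
move=> ndphi mq q01; pose clamp (x : R) := Num.max 0 (Num.min 1 x).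
have clamp01 x : clamp x \in `[0, 1]%R.
  by rewrite in_itv/= le_max lexx ge_max ler01 ge_min lexx.
rewrite (_ : (fun _ => _) = (phi \o clamp) \o q); last first.
  apply/funext => x /=; have /andP[q0 q1] := q01 x.
  by rewrite /clamp min_r// max_r.
apply: measurableT_comp => //; apply: nondecreasing_measurable => // x y xy /=.
apply: ndphi => //; rewrite /clamp ge_max le_max lexx/= le_max.
by apply/orP; right; rewrite le_min !ge_min lexx xy orbT.
Qed.

End convex.

(** * Conditional risks of one label at a point *)

Section pointwise_risk.
Context {R : realType} (L K : nat).
Implicit Types e u v t : R.
Local Notation p0 := (p0 R L K).
Local Notation p1 := (p1 R L K).
Hypotheses (p0_ge0 : 0 <= p0) (p1_ge0 : 0 <= p1).

(** The conditional 0/1 risk of a label. It has the shape of [risk_pt], with sign indicators as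
    losses, so that [label_riskE] covers both risks. *)
Definition risk01_pt e v : R :=
  p1 * e * (v < 0)%R%:R + p0 * (1 - e) * (0 <= v)%R%:R.

Lemma risk01_pt_ge0 e v : 0 <= e <= 1 -> 0 <= risk01_pt e v.
Proof. by move=> /andP[e0 e1]; rewrite addr_ge0 ?mulr_ge0// subr_ge0. Qed.

Lemma risk01_pt_le1 e v : 0 <= e <= 1 -> risk01_pt e v <= 1.
Proof.
move: p0_ge0 p1_ge0; rewrite /risk01_pt /Defs.p1 => p00 p10 /andP[e0 e1].
by case: (ltP v 0) => _ /=; rewrite mulr1 mulr0; nra.
Qed.

(** Since the weights sum to 1, predicting 1 costs p0 (1 - e) - p1 e = p0 - e more than predicting
    0. Hence [p0] is the optimal threshold, and a wrong sign costs exactly the distance of [e] to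
    it. *)
Lemma risk01_pt_excess e u v :
  risk01_pt e u <= risk01_pt e v +
    `|p0 - e| * ((0 <= u) && (e < p0) || (u < 0) && (p0 < e))%R%:R.
Proof.
rewrite /risk01_pt /Defs.p1.
case: (ltP u 0); case: (ltP v 0); case: (ltgtP e p0) => /=;
 rewrite ?mulr1 ?mulr0 ?addr0 ?add0r => ? ? ?;
 try (rewrite ger0_norm; last by lra); try (rewrite ler0_norm; last by lra);
 try nra.
Qed.

Section surrogate.
Context (phi : R -> R) (fstar : 'I_L -> R -> R).
Hypotheses (phi_ge0 : forall v, 0 <= phi v)
  (phi_convex : convex_function [set: R^o] phi)
  (fstarP : is_minimizer K phi fstar).

Lemma risk_pt_ge0 e v : 0 <= e <= 1 -> 0 <= risk_pt L K phi e v.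
Proof. by move=> /andP[e0 e1]; rewrite addr_ge0 ?mulr_ge0// subr_ge0. Qed.

Lemma risk_pt_convex e : 0 <= e <= 1 ->
  convex_function [set: R^o] (risk_pt L K phi e).
Proof.
move=> /andP[e0 e1] t x y _ _.
(* The convex combination is restated with an ordinary real weight, on which ring identities
   apply. *)
suff : forall u x y : R, u = t%:num ->
    risk_pt L K phi e (u * x + (1 - u) * y) <=
    u * risk_pt L K phi e x + (1 - u) * risk_pt L K phi e y by exact.
move=> {x y} u x y uE.
have cphi (a b : R) : phi (u * a + (1 - u) * b) <= u * phi a + (1 - u) * phi b.
  by rewrite uE; apply: phi_convex; rewrite inE.
have le1 := ler_wpM2l (mulr_ge0 p1_ge0 e0) (cphi x y).
have e1' : 0 <= 1 - e by rewrite subr_ge0.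
have := lerD le1 (ler_wpM2l (mulr_ge0 p0_ge0 e1') (cphi (- x) (- y))).
rewrite /risk_pt (_ : u * - x + (1 - u) * - y = - (u * x + (1 - u) * y));
  last by ring.
by move=> /le_trans; apply; rewrite le_eqVlt; apply/orP; left; apply/eqP; ring.
Qed.

(* Monotonicity in [e] holds for every choice of the minimizers, so that these
   functions are measurable even when [fstar l] is not. *)
Lemma risk_pt_minimizer_monotone (l : 'I_L) e1 e2 :
  0 <= e1 -> e1 <= e2 -> e2 <= 1 ->
  p1 * phi (fstar l e2) <= p1 * phi (fstar l e1) /\
  p0 * phi (- fstar l e1) <= p0 * phi (- fstar l e2).
Proof.
move=> e10; rewrite le_eqVlt => /orP[/eqP->//|e12] e21.
have e11 : 0 <= e1 <= 1 by lra.
have e22 : 0 <= e2 <= 1 by lra.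
have := fstarP l e11 (fstar l e2); have := fstarP l e22 (fstar l e1).
rewrite /risk_pt.
set a1 := phi (fstar l e1); set a2 := phi (fstar l e2).
set b1 := phi (- fstar l e1); set b2 := phi (- fstar l e2) => H2 H1.
(* The minimality inequalities at [e1] and [e2] are added and divided by [e2 - e1]. *)
have ab : p1 * a2 - p1 * a1 <= p0 * b2 - p0 * b1.
  by rewrite -(@ler_pM2l _ (e2 - e1)) ?subr_gt0//; lra.
(* Minimality at [e2] makes the average of the two differences in [ab] with weight [e2] nonpositive,
   so the smaller one is; minimality at [e1] makes the average with weight [e1] nonnegative, so the
   larger one is. *)
by split; nra.
Qed.

Context (c s : R).
Hypotheses (s_ge1 : 1 <= s) (fstar_cal : classification_calibrated K fstar)
  (excess0 : forall (l : 'I_L) e, 0 <= e <= 1 ->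
    `|p0 - e| `^ s <= c `^ s * excess_pt K phi fstar l e 0).

(** By calibration 0 lies between [v] and the minimizer; of these two endpoints, [v] has the larger
    risk, which therefore bounds the convex risk in between. *)
Lemma excess_pt_mismatch (l : 'I_L) e v : 0 <= e <= 1 ->
  (0 <= v) && (e < p0) || (v < 0) && (p0 < e) ->
  excess_pt K phi fstar l e 0 <= excess_pt K phi fstar l e v.
Proof.
move=> e01; have [calp caln] := fstar_cal l e01.
rewrite lerD2r; have cvx := risk_pt_convex e01.
case/orP => /andP[v0].
  move=> /caln f0.
  apply: (convex_le_between (a := fstar l e) (b := v)) cvx _ _ _ => //.
  - by rewrite ltW.
  - exact: fstarP.
move=> /calp f0.
  apply: (convex_le_between (a := v) (b := fstar l e)) cvx _ _ _ => //.
- by rewrite !ltW.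
- exact: fstarP.
Qed.

Lemma risk01_pt_surrogate (l : 'I_L) e u v t k : 0 <= e <= 1 -> 0 < t ->
  k = c `^ s * (t / t `^ s) / s ->
  risk01_pt e u + k * risk_pt L K phi e (fstar l e) <=
  risk01_pt e v + k * risk_pt L K phi e u + (1 - s^-1) * t.
Proof.
move=> e01 t0 kE; have s0 : 0 < s by apply: lt_le_trans s_ge1.
have tts : 0 <= t / t `^ s by rewrite divr_ge0// ?powR_ge0// ltW.
have k0 : 0 <= k by rewrite kE divr_ge0 ?(ltW s0)// mulr_ge0// powR_ge0.
have st0 : 0 <= (1 - s^-1) * t.
  by rewrite mulr_ge0 ?(ltW t0)// subr_ge0 invf_le1.
have := risk01_pt_excess e u v.
(* Without a sign mismatch, or when [e = p0], the 0/1 excess vanishes and minimality of [fstar l e]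
   suffices. *)
case: (boolP (_ || _)) => [mis|_]; last first.
  by rewrite mulr0 addr0; have := ler_wpM2l k0 (fstarP l e01 u); lra.
rewrite mulr1; have := powR_young s_ge1 t0 (normr_ge0 (p0 - e)).
have : `|p0 - e| `^ s * (t / t `^ s) / s <= k * excess_pt K phi fstar l e u.
  rewrite kE [leRHS](_ : _ =
    c `^ s * excess_pt K phi fstar l e u * (t / t `^ s / s)); last by ring.
  rewrite -mulrA ler_wpM2r//; first by rewrite divr_ge0// ltW.
  apply: le_trans (excess0 l e01) _.
  by rewrite ler_wpM2l ?powR_ge0//; exact: excess_pt_mismatch.
rewrite /excess_pt mulrBr; lra.
Qed.

End surrogate.
End pointwise_risk.

(** * Conditioning on X inside expectations *)

Section conditional_probability.
Context {R : realType} d d' (Omega : measurableType d) (T : measurableType d').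
Context (P : probability Omega R) (X : {RV P >-> T}).
Implicit Types (A : set Omega) (q : T -> R).
Local Open Scope ereal_scope.

Lemma is_cond_probC A q : measurable A -> is_cond_prob X A q ->
  is_cond_prob X (~` A) (fun x => 1 - q x)%R.
Proof.
move=> mA [mq q01 qA]; split.
- exact: measurable_funB.
- by move=> x; move: (q01 x); rewrite subr_ge0 lerBlDr lerDl andbC.
- move=> B mB; have mXB : measurable (X @^-1` B).
    by rewrite -[_ @^-1` _]setTI; exact: measurable_funPT.
  have mX (g : T -> R) : measurable_fun [set: T] g ->
      measurable_fun (X @^-1` B) (fun w => (g (X w))%:E).
    move=> mg; apply/measurable_EFinP/measurable_funTS.
    exact: measurableT_comp.
  have PXB : P (X @^-1` B) \is a fin_num by exact: fin_num_measure.
  have : \int[P]_(w in X @^-1` B) 1 = P (X @^-1` B).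
    by rewrite integral_cst// mul1e.
  (* The constant 1 is split as q + (1 - q); the integral of q is a finite probability and can be
     subtracted. *)
  under eq_integral => w _ do rewrite -(subrKC (q (X w)) 1%R) EFinD.
  rewrite ge0_integralD//; last 4 first.
  - by move=> w _; rewrite lee_fin; case/andP: (q01 (X w)).
  - exact: mX.
  - by move=> w _; rewrite lee_fin subr_ge0; case/andP: (q01 (X w)).
  - by apply: (mX (fun x => 1 - q x)%R); exact: measurable_funB.
  rewrite -qA// => PE.
  have PA : P (X @^-1` B `&` A) \is a fin_num.
    by apply: fin_num_measure; exact: measurableI.
  rewrite -setDE measureD//; last by rewrite ltey_eq PXB.
  by rewrite -[RHS](addeK _ PA); congr (_ - _); rewrite addeC; exact/esym.
Qed.

Import HBNNSimple.

(** The defining property of [q] is the case of indicators; linearity extends it to simple functions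
    and monotone convergence to nonnegative measurable ones. *)
Lemma integral_cond_prob A q (h : T -> \bar R) :
  measurable A -> is_cond_prob X A q ->
  measurable_fun [set: T] h -> (forall x, 0 <= h x) ->
  \int[P]_(w in A) h (X w) = \int[P]_w (h (X w) * (q (X w))%:E).
Proof.
move=> mA [mq q01 qA] mh h0.
have mX : measurable_fun [set: Omega] X by exact: measurable_funPT.
have q0 x : 0 <= (q x)%:E by rewrite lee_fin; case/andP: (q01 x).
have mqX : measurable_fun [set: Omega] (fun w => (q (X w))%:E).
  by apply/measurable_EFinP; exact: measurableT_comp.
pose g := nnsfun_approx measurableT mh.
have mgX n : measurable_fun [set: Omega] (fun w => (g n (X w))%:E).
  apply/measurable_EFinP.
  exact: (@measurableT_comp _ _ _ _ _ _ (g n) _ X).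
have cvgh x : (g n x)%:E @[n --> \oo] --> h x by exact: cvg_nnsfun_approx.
have ndg x a b : (a <= b)%N -> (g a x <= g b x)%R.
  by move=> ab; exact/lefP/nd_nnsfun_approx.
have -> : \int[P]_(w in A) h (X w) =
    lim (\int[P]_(w in A) (g n (X w))%:E @[n --> \oo]).
  rewrite -monotone_convergence//.
  - by apply: eq_integral => w _; apply/esym/cvg_lim.
  - by move=> n; exact: measurable_funTS.
  - by move=> n w _; rewrite lee_fin.
  - by move=> w _ a b ab; rewrite lee_fin ndg.
have -> : \int[P]_w (h (X w) * (q (X w))%:E) =
    lim (\int[P]_w ((g n (X w))%:E * (q (X w))%:E) @[n --> \oo]).
  rewrite -monotone_convergence//.
  - apply: eq_integral => w _; apply/esym/cvg_lim => //.
    by apply: cvgeZr.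
  - by move=> n; exact: emeasurable_funM.
  - by move=> n w _; rewrite mule_ge0// lee_fin.
  - by move=> w _ a b ab; rewrite lee_wpmul2r// lee_fin ndg.
congr (lim (_ @ \oo)); apply/funext => n.
have mI r : measurable (X @^-1` (g n @^-1` [set r])).
  by rewrite -[_ @^-1` _]setTI; exact: mX.
have mf r : measurable_fun [set: Omega]
    (fun w => (r * \1_(X @^-1` (g n @^-1` [set r])) w)%:E).
  by apply/measurable_EFinP; exact: measurable_funM.
have f0 r w : 0 <= (r * \1_(X @^-1` (g n @^-1` [set r])) w)%:E.
  by rewrite EFinM; exact: (nnfun_muleindic_ge0 (g n) r (X w)).
(* The simple function is decomposed over its level sets, so that each term falls under the
   definition of [is_cond_prob]. *)
have gE w : (g n (X w))%:E = \sum_(r \in range (g n))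
    (r * \1_(X @^-1` (g n @^-1` [set r])) w)%:E.
  by rewrite fimfunE -fsumEFin.
under eq_integral do rewrite gE.
rewrite ge0_integral_fsum//; last by move=> r; exact: measurable_funTS.
under [RHS]eq_integral do rewrite gE ge0_mule_fsuml//.
rewrite ge0_integral_fsum//; last 2 first.
  - by move=> r; exact: emeasurable_funM.
  - by move=> r w _; rewrite mule_ge0.
apply: eq_fsbigr => r; rewrite inE => -[x _ rE].
have r0 : (0 <= r)%R by rewrite -rE.
have m1 : measurable_fun [set: Omega]
    (fun w => (\1_(X @^-1` (g n @^-1` [set r])) w : R)%:E).
  exact/measurable_EFinP.
under eq_integral do rewrite EFinM.
rewrite ge0_integralZl//; last exact: measurable_funTS.
under [RHS]eq_integral do rewrite EFinM -muleA.
rewrite ge0_integralZl//; last 2 first.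
  - exact: emeasurable_funM.
  - by move=> w _; rewrite mule_ge0// lee_fin.
congr (_ * _); rewrite integral_indic//; etransitivity; first exact: qA.
rewrite [LHS]integral_mkcond; apply: eq_integral => w _.
by rewrite epatch_indic/= muleC.
Qed.

Lemma expectation_cond_prob A q (h : T -> R) :
  measurable A -> is_cond_prob X A q ->
  measurable_fun [set: T] h -> (forall x, 0 <= h x)%R ->
  'E_P[fun w => (h (X w) * \1_A w)%R] = \int[P]_w (h (X w) * q (X w))%:E.
Proof.
move=> mA qA mh h0; rewrite unlock.
transitivity (\int[P]_w ((fun w => (h (X w))%:E) \_ A) w).
  by apply: eq_integral => w _; rewrite epatch_indic/= EFinM.
rewrite -integral_mkcond (integral_cond_prob (h := EFin \o h) mA qA)//.
exact/measurable_EFinP.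
Qed.

(** Only the product of [a] and [h] is assumed measurable: for the loss at the minimizers,
    monotonicity gives measurability of the weighted loss only, and a weight may vanish. If [a = 0]
    both sides are 0; otherwise [h] is recovered by dividing. *)
Lemma scaled_expectation_cond_prob A q (a : R) (h : T -> R) :
  measurable A -> is_cond_prob X A q -> (0 <= a)%R -> (forall x, 0 <= h x)%R ->
  measurable_fun [set: T] (fun x => a * h x)%R ->
  a%:E * 'E_P[fun w => (h (X w) * \1_A w)%R] =
  \int[P]_w (a * h (X w) * q (X w))%:E.
Proof.
move=> mA qA a0 h0 mah; have [->|an0] := eqVneq a 0%R.
  by rewrite mul0e integral0_eq// => w _; rewrite !mul0r.
have mh : measurable_fun [set: T] h.
  rewrite (_ : h = fun x => a^-1 * (a * h x))%R; last first.
    by apply/funext => x; rewrite mulKf.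
  exact: measurable_funM.
rewrite (expectation_cond_prob mA qA)// -ge0_integralZl_EFin//.
- by apply: eq_integral => w _; rewrite -EFinM mulrA.
- move=> w _; case: qA => _ /(_ (X w))/andP[q0 _] _.
  by rewrite lee_fin mulr_ge0.
- apply/measurable_EFinP.
  case: qA => mq _ _.
  apply: (measurableT_comp (f := fun x => h x * q x)%R) => //.
  exact: measurable_funM.
Qed.

End conditional_probability.

(** * Risks as integrals of conditional risks *)

Section risks.
Context {R : realType} d (Omega : measurableType d).
Context (P : probability Omega R) (D L K : nat).
Context (X : {RV P >-> D.-tuple R}) (Y : {RV P >-> L.-tuple bool}).
Context (eta : D.-tuple R -> L.-tuple R).
Hypothesis etaP : forall l : 'I_L,
  is_cond_prob X [set w | tnth (Y w) l = true] (fun x => tnth (eta x) l).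
Local Notation p0 := (p0 R L K).
Local Notation p1 := (p1 R L K).
Hypotheses (p0_ge0 : 0 <= p0) (p1_ge0 : 0 <= p1).
Local Open Scope ereal_scope.

Lemma eta01 l x : (0 <= tnth (eta x) l <= 1)%R.
Proof. by case: (etaP l). Qed.

Lemma measurable_eta l :
  measurable_fun [set: D.-tuple R] (fun x => tnth (eta x) l).
Proof. by case: (etaP l). Qed.

Lemma measurable_label l : measurable [set w | tnth (Y w) l = true].
Proof.
have mY : measurable_fun [set: Omega] Y by exact: measurable_funPT.
have mYl : measurable_fun [set: Omega] (fun w => tnth (Y w) l).
  exact: (measurableT_comp (measurable_tnth l) mY).
by have := mYl measurableT [set true] I; rewrite setTI.
Qed.

(** [h0] and [h1] are the losses for labels 0 and 1. The label factors are indicators of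
    complementary events, with conditional probabilities 1 - eta and eta. *)
Lemma label_riskE l (a b : R) (h0 h1 : D.-tuple R -> R) :
  (0 <= a)%R -> (0 <= b)%R ->
  (forall x, 0 <= h0 x)%R -> (forall x, 0 <= h1 x)%R ->
  measurable_fun [set: D.-tuple R] (fun x => a * h0 x)%R ->
  measurable_fun [set: D.-tuple R] (fun x => b * h1 x)%R ->
  a%:E * 'E_P[fun w => (h0 (X w) * (tnth (Y w) l == false)%:R)%R] +
  b%:E * 'E_P[fun w => (h1 (X w) * (tnth (Y w) l == true)%:R)%R] =
  \int[P]_w (b * tnth (eta (X w)) l * h1 (X w) +
             a * (1 - tnth (eta (X w)) l) * h0 (X w))%:E.
Proof.
move=> a0 b0 h00 h10 mh0 mh1.
have mA := measurable_label l; set A := [set w | _] in mA.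
have memA w : (w \in A) = tnth (Y w) l by apply/idP/idP; rewrite inE.
have AE w : (tnth (Y w) l == true)%:R = \1_A w :> R.
  by rewrite indicE memA eqb_id.
have AcE w : (tnth (Y w) l == false)%:R = \1_(~` A) w :> R.
  by rewrite indicE in_setC memA eqbF_neg.
under eq_fun do rewrite AcE.
under [X in _ + _ * 'E_P[X]]eq_fun do rewrite AE.
rewrite (scaled_expectation_cond_prob (measurableC mA)
  (is_cond_probC mA (etaP l)))//.
rewrite (scaled_expectation_cond_prob mA (etaP l))//.
have mX : measurable_fun [set: Omega] X by exact: measurable_funPT.
have me := measurable_eta l.
rewrite -ge0_integralD//.
- by apply: eq_integral => w _; rewrite -EFinD addrC; congr EFin; ring.
- move=> w _; case/andP: (eta01 l (X w)) => e0 e1.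
  by rewrite lee_fin !mulr_ge0// subr_ge0.
- apply/measurable_EFinP.
  apply: (measurableT_comp
    (f := fun x => a * h0 x * (1 - tnth (eta x) l))%R) => //.
  apply: measurable_funM => //; exact: measurable_funB.
- by move=> w _; case/andP: (eta01 l (X w)) => e0 e1; rewrite lee_fin !mulr_ge0.
- apply/measurable_EFinP.
  apply: (measurableT_comp (f := fun x => b * h1 x * tnth (eta x) l)%R) => //.
  exact: measurable_funM.
Qed.

Lemma measurable_label_risk l (a b : R) (h0 h1 : D.-tuple R -> R) :
  measurable_fun [set: D.-tuple R] (fun x => a * h0 x)%R ->
  measurable_fun [set: D.-tuple R] (fun x => b * h1 x)%R ->
  measurable_fun [set: Omega] (fun w => b * tnth (eta (X w)) l * h1 (X w) +
     a * (1 - tnth (eta (X w)) l) * h0 (X w))%R.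
Proof.
move=> mh0 mh1.
have mX : measurable_fun [set: Omega] X by exact: measurable_funPT.
have me := measurable_eta l.
rewrite (_ : (fun _ => _) = (fun x => b * h1 x * tnth (eta x) l +
    a * h0 x * (1 - tnth (eta x) l))%R \o X); last first.
  by apply/funext => w /=; ring.
apply: measurableT_comp => //.
apply: measurable_funD; apply: measurable_funM => //.
exact: measurable_funB.
Qed.

Lemma measurable_tnth_fun l (f : D.-tuple R -> L.-tuple R) :
  measurable_fun [set: D.-tuple R] f ->
  measurable_fun [set: D.-tuple R] (fun x => tnth (f x) l).
Proof. by move=> mf; exact: (measurableT_comp (measurable_tnth l) mf). Qed.

Lemma measurable_sign d' (T : measurableType d') (g : T -> R) :
  measurable_fun [set: T] g ->
  measurable_fun [set: T] (fun x => (g x < 0)%R%:R : R) /\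
  measurable_fun [set: T] (fun x => (0 <= g x)%R%:R : R).
Proof.
move=> mg.
split; [pose i : interval R := `]-oo, 0%R[ |
        pose i : interval R := `[0%R, +oo[];
  rewrite (_ : (fun _ => _) = \1_[set` i] \o g);
  try exact: measurableT_comp;
  apply/funext => x /=; rewrite indicE; congr (_%:R); congr nat_of_bool;
  by apply/idP/idP; rewrite inE /i/= in_itv/= ?andbT.
Qed.

Lemma measurable_risk01_pt l (f : D.-tuple R -> L.-tuple R) :
  measurable_fun [set: D.-tuple R] f ->
  measurable_fun [set: Omega]
    (fun w => risk01_pt L K (tnth (eta (X w)) l) (tnth (f (X w)) l)).
Proof.
move=> /(measurable_tnth_fun l)/measurable_sign[mlt mge].
apply: (@measurable_label_risk l p0 p1 (fun x => (0 <= tnth (f x) l)%R%:R)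
  (fun x => (tnth (f x) l < 0)%R%:R)); exact: measurable_funM.
Qed.

Lemma risk01E (f : D.-tuple R -> L.-tuple R) :
  measurable_fun [set: D.-tuple R] f ->
  risk01 K X Y f = \sum_(l < L)
    \int[P]_w (risk01_pt L K (tnth (eta (X w)) l) (tnth (f (X w)) l))%:E.
Proof.
move=> mf; apply: eq_bigr => l _.
have /measurable_sign[mlt mge] := measurable_tnth_fun l mf.
by rewrite (@label_riskE l p0 p1 (fun x => (0 <= tnth (f x) l)%R%:R)
  (fun x => (tnth (f x) l < 0)%R%:R))//; exact: measurable_funM.
Qed.

Lemma measurable_risk_pt l (phi : R -> R) (f : D.-tuple R -> L.-tuple R) :
  measurable_fun [set: D.-tuple R] (fun x => p0 * phi (- tnth (f x) l))%R ->
  measurable_fun [set: D.-tuple R] (fun x => p1 * phi (tnth (f x) l))%R ->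
  measurable_fun [set: Omega]
    (fun w => risk_pt L K phi (tnth (eta (X w)) l) (tnth (f (X w)) l)).
Proof.
exact: (@measurable_label_risk l p0 p1 (fun x => phi (- tnth (f x) l)%R)
  (fun x => phi (tnth (f x) l)%R)).
Qed.

Lemma risk_phiE (phi : R -> R) (f : D.-tuple R -> L.-tuple R) :
  (forall v, 0 <= phi v)%R ->
  (forall l, measurable_fun [set: D.-tuple R]
    (fun x => p0 * phi (- tnth (f x) l))%R) ->
  (forall l, measurable_fun [set: D.-tuple R]
    (fun x => p1 * phi (tnth (f x) l))%R) ->
  risk_phi K X Y phi f = \sum_(l < L)
    \int[P]_w (risk_pt L K phi (tnth (eta (X w)) l) (tnth (f (X w)) l))%:E.
Proof.
move=> phi0 m0 m1; apply: eq_bigr => l _.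
by rewrite (@label_riskE l p0 p1 (fun x => phi (- tnth (f x) l)%R)
  (fun x => phi (tnth (f x) l)%R)).
Qed.

(** The inequality is kept free of subtractions, so integrals equal to +oo are allowed. Each of the
    [L] labels contributes [r], as [P] has mass 1. *)
Lemma sum_integral_le (a b g h : 'I_L -> Omega -> R) (k r : R) :
  (forall l, measurable_fun [set: Omega] (a l)) ->
  (forall l, measurable_fun [set: Omega] (b l)) ->
  (forall l, measurable_fun [set: Omega] (g l)) ->
  (forall l, measurable_fun [set: Omega] (h l)) ->
  (forall l w, 0 <= a l w)%R -> (forall l w, 0 <= b l w)%R ->
  (forall l w, 0 <= g l w)%R -> (forall l w, 0 <= h l w)%R ->
  (0 <= k)%R -> (0 <= r)%R ->
  (forall l w, a l w + k * b l w <= g l w + k * h l w + r)%R ->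
  \sum_(l < L) \int[P]_w (a l w)%:E +
    k%:E * \sum_(l < L) \int[P]_w (b l w)%:E <=
  \sum_(l < L) \int[P]_w (g l w)%:E +
    k%:E * \sum_(l < L) \int[P]_w (h l w)%:E
    + (r * L%:R)%:E.
Proof.
move=> ma mb mg mh a0 b0 g0 h0 k0 r0 le_abgh.
have -> : (r * L%:R)%:E = \sum_(l < L) \int[P]_w r%:E.
  under eq_bigr do rewrite integral_cst//= probability_setT mule1.
  by rewrite sumEFin sumr_const card_ord mulr_natr.
rewrite !ge0_sume_distrr;
  try by move=> l _; apply: integral_ge0 => w _; rewrite lee_fin.
rewrite -!big_split/=; apply: lee_sum => l _.
have intD (u v : Omega -> R) :
    measurable_fun [set: Omega] u -> measurable_fun [set: Omega] v ->
    (forall w, 0 <= u w)%R -> (forall w, 0 <= v w)%R ->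
    \int[P]_w (u w)%:E + k%:E * \int[P]_w (v w)%:E =
    \int[P]_w (u w + k * v w)%:E.
  move=> mu mv u0 v0.
  rewrite -ge0_integralZl_EFin//.
  - rewrite -ge0_integralD//.
    + by move=> w _; rewrite lee_fin.
    + exact/measurable_EFinP.
    + by move=> w _; rewrite -EFinM lee_fin mulr_ge0.
    + by apply/measurable_EFinP; exact: measurable_funM.
  - by move=> w _; rewrite lee_fin.
  - exact/measurable_EFinP.
rewrite !intD// -ge0_integralD//.
- apply: ge0_le_integral => //.
  + by move=> w _; rewrite lee_fin addr_ge0// mulr_ge0.
  + apply/measurable_EFinP; apply: measurable_funD => //.
    exact: measurable_funM.
  + apply/measurable_EFinP; apply: measurable_funD => //.
    apply: measurable_funD => //; exact: measurable_funM.
  + by move=> w _; rewrite -EFinD lee_fin.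
- by move=> w _; rewrite lee_fin addr_ge0// mulr_ge0.
- apply/measurable_EFinP; apply: measurable_funD => //; exact: measurable_funM.
Qed.

Lemma sum_integral_bounded (a : 'I_L -> Omega -> R) (b : R) :
  (forall l, measurable_fun [set: Omega] (a l)) ->
  (forall l w, 0 <= a l w <= b)%R ->
  \sum_(l < L) \int[P]_w (a l w)%:E \is a fin_num.
Proof.
move=> ma ab; apply/sum_fin_numP => l _ _.
have a0 w : 0 <= (a l w)%:E by rewrite lee_fin; case/andP: (ab l w).
rewrite ge0_fin_numE; last exact: integral_ge0.
apply: (@le_lt_trans _ _ (\int[P]_w b%:E)).
  apply: ge0_le_integral => //; first exact/measurable_EFinP.
  by move=> w _; rewrite lee_fin; case/andP: (ab l w).
by rewrite integral_cst//= probability_setT mule1 ltry.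
Qed.

End risks.

(** * Integration of the pointwise bound and passage to the infimum *)

Theorem lemma3 (R : realType) (d : measure_display) (Omega : measurableType d)
    (P : probability Omega R) (D L K : nat)
    (X : {RV P >-> D.-tuple R}) (Y : {RV P >-> L.-tuple bool})
    (eta : D.-tuple R -> L.-tuple R)
    (phi : R -> R) (fstar : 'I_L -> R -> R) (c s : R)
    (heta : forall l : 'I_L,
      is_cond_prob X [set w | tnth (Y w) l = true] (fun x => tnth (eta x) l))
    (hK0 : (0 < K)%N) (hKL : (K < L)%N)
    (hp0 : 0 <= p0 R L K) (hp1 : 0 <= p1 R L K)
    (hsparse : exists2 q : D.-tuple R -> R,
      is_cond_prob X [set w | (K < \sum_(l < L) (tnth (Y w) l == true))%N] q &
      {ae P, forall w, q (X w) = 0})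
    (hphi0 : forall v, 0 <= phi v)
    (hconv : convex_function [set: R^o] phi)
    (hmin : is_minimizer K phi fstar)
    (hcal : classification_calibrated K fstar)
    (hc : 0 < c) (hs : 1 <= s)
    (hcs : forall (l : 'I_L) (e : R), 0 <= e <= 1 ->
      `|p0 R L K - e| `^ s <= c `^ s * excess_pt K phi fstar l e 0)
    (f : D.-tuple R -> L.-tuple R) (hf : measurable_fun [set: D.-tuple R] f) :
  (risk01 K X Y f - risk01_opt K X Y
   <= (c * L%:R `^ ((s - 1) / s))%:E
      * poweR (risk_phi K X Y phi f
               - risk_phi K X Y phi (compose_fstar fstar eta)) s^-1)%E.
Proof.
have e01 l x := eta01 heta l x.
have me l := measurable_eta heta l.
have mphi := convex_measurable hconv.
have n0 : 0 < L%:R :> R by rewrite ltr0n (leq_trans _ hKL).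
have s0 : 0 < s by apply: lt_le_trans hs.
have tstar l x : tnth (compose_fstar fstar eta x) l = fstar l (tnth (eta x) l).
  by rewrite tnth_mktuple.
(* The minimizers are arbitrary choices, so measurability comes from monotonicity in [e] of their
   weighted losses. *)
have mstar0 l : measurable_fun [set: D.-tuple R]
    (fun x => p0 R L K * phi (- tnth (compose_fstar fstar eta x) l)).
  under eq_fun do rewrite tstar.
  apply: (measurable_nondecreasing01
    (phi := fun e => p0 R L K * phi (- fstar l e))) => // x y.
  rewrite !in_itv/= => /andP[x0 _] /andP[_ y1] xy.
  by have [] := risk_pt_minimizer_monotone hmin l x0 xy y1.
have mstar1 l : measurable_fun [set: D.-tuple R]
    (fun x => p1 R L K * phi (tnth (compose_fstar fstar eta x) l)).
  (* This loss is nonincreasing in [e]; its opposite is treated instead. *)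
  under eq_fun do rewrite tstar -[_ * _]opprK.
  apply: measurableT_comp => //; apply: (measurable_nondecreasing01
    (phi := fun e => - (p1 R L K * phi (fstar l e)))) => // x y.
  rewrite !in_itv/= => /andP[x0 _] /andP[_ y1] xy; rewrite lerN2.
  by have [] := risk_pt_minimizer_monotone hmin l x0 xy y1.
have mf0 l : measurable_fun [set: D.-tuple R]
    (fun x => p0 R L K * phi (- tnth (f x) l)).
  apply: measurable_funM => //; apply: measurableT_comp => //.
  by apply: measurableT_comp => //; exact: measurable_tnth_fun.
have mf1 l : measurable_fun [set: D.-tuple R]
    (fun x => p1 R L K * phi (tnth (f x) l)).
  apply: measurable_funM => //; apply: measurableT_comp => //.
  exact: measurable_tnth_fun.
have mrisk0 l := measurable_risk_pt heta (mstar0 l) (mstar1 l).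
have mriskf l := measurable_risk_pt heta (mf0 l) (mf1 l).
have m01 g mg l := measurable_risk01_pt K heta l (f := g) mg.
have risk01_fin g : measurable_fun [set: D.-tuple R] g ->
    risk01 K X Y g \is a fin_num.
  move=> mg; rewrite (risk01E heta)//.
  apply: (@sum_integral_bounded _ _ _ P L _ 1) => [l|l w].
    exact: m01.
  by rewrite risk01_pt_ge0// risk01_pt_le1.
(* The competitor [g] and the parameter [t] stay free; they are optimized separately at the end. *)
have le_risk g t k : measurable_fun [set: D.-tuple R] g -> 0 < t ->
    k = c `^ s * (t / t `^ s) / s ->
    (risk01 K X Y f + k%:E * risk_phi K X Y phi (compose_fstar fstar eta) <=
     risk01 K X Y g + k%:E * risk_phi K X Y phi f +
     ((1 - s^-1) * t * L%:R)%:E)%E.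
  move=> mg t0 kE; rewrite !(risk01E heta)// !(risk_phiE heta)//.
  apply: sum_integral_le => //.
  - by move=> l; exact: m01.
  - by move=> l; exact: m01.
  - by move=> l w; rewrite risk01_pt_ge0.
  - by move=> l w; rewrite risk_pt_ge0.
  - by move=> l w; rewrite risk01_pt_ge0.
  - by move=> l w; rewrite risk_pt_ge0.
  - rewrite kE divr_ge0 ?(ltW s0)// mulr_ge0 ?powR_ge0//.
    by rewrite divr_ge0 ?powR_ge0// ltW.
  - by rewrite mulr_ge0 ?(ltW t0)// subr_ge0 invf_le1.
  - by move=> l w; rewrite tstar; apply: risk01_pt_surrogate kE.
(* The minimal conditional risk is at most its value at the score 0, which is (p1 e + p0 (1 - e))
   phi(0) <= phi(0). *)
have star_fin : risk_phi K X Y phi (compose_fstar fstar eta) \is a fin_num.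
  rewrite (risk_phiE heta)//.
  apply: (@sum_integral_bounded _ _ _ P L _ (phi 0)) => [l|l w].
    exact: mrisk0.
  rewrite risk_pt_ge0// tstar (le_trans (hmin l _ (e01 l _) 0))//.
  rewrite /risk_pt oppr0 -mulrDl ler_piMl//.
  by have /andP[] := e01 l (X w); move: hp0 hp1; rewrite /p1; nra.
have star_le : (risk_phi K X Y phi (compose_fstar fstar eta) <=
    risk_phi K X Y phi f)%E.
  rewrite !(risk_phiE heta)//; apply: lee_sum => l _.
  apply: ge0_le_integral => //.
  - by move=> w _; rewrite lee_fin risk_pt_ge0.
  - exact/measurable_EFinP.
  - exact/measurable_EFinP.
  - by move=> w _; rewrite lee_fin tstar hmin.
have := risk01_fin f hf; case: (risk01 K X Y f) le_risk => // a le_risk _.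
case: (risk_phi K X Y phi (compose_fstar _ _)) star_fin star_le
  le_risk => // m _.
case: (risk_phi K X Y phi f) => // [v|] mv le_risk; last first.
  (* If the phi-risk of [f] is +oo, so is the right-hand side, its coefficient being positive. *)
  rewrite addye// poweRyr ?invr_eq0 ?gt_eqF// gt0_muley ?leey//.
  by rewrite lte_fin mulr_gt0// powR_gt0.
set Z := c * L%:R `^ ((s - 1) / s) * (v - m) `^ s^-1.
(* It suffices that a - Z bounds the 0/1 risk of every measurable competitor from below. *)
suff : ((a - Z)%:E <= risk01_opt K X Y)%E.
  rewrite -EFinB poweR_EFin -EFinM -/Z.
  case: (risk01_opt K X Y) => // o; last by rewrite leNye.
  rewrite -EFinB !lee_fin; lra.
apply: le_ereal_inf_tmp => _ [g mg <-].
have := risk01_fin g mg; have {}le_risk t k := le_risk g t k mg.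
case: (risk01 K X Y g) le_risk => // b le_risk _; rewrite lee_fin.
suff : a - b <= Z by lra.
(* Here A = a - b, E = v - m and n = L. *)
apply: young_optimum => //; first by rewrite subr_ge0.
move=> t t0; have := le_risk t _ t0 erefl; rewrite -!EFinM -!EFinD lee_fin; lra.
Qed.
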